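(* Let $\mathcal{H}$ be a complex Hilbert space and $T\in\mathcal{B}(\mathcal{H})$. For all real $\alpha,\beta\ge 0$ with $(\alpha,\beta)\ne(0,0)$: (i) $$\|T\|_{\alpha,\beta}^2\ge \max\left\{\frac12\left\|\frac{\alpha}{4}(T^*T+TT^* )+\beta T^*T\right\|,\ \frac13\left\|\frac{\alpha}{2}(T^*T+TT^* )+\beta T^*T\right\|\right\};$$ (ii) $$\|T\|_{\alpha,\beta}^2\le \left\|\frac{\alpha}{2}(T^*T+TT^* )+\beta T^*T\right\|.$$ Moreover, (iii) $$w^2(T)\le \inf_{\alpha,\beta}\frac{1}{\alpha+\beta}\left\|\frac{\alpha}{2}(T^*T+TT^* )+\beta T^*T\right\|\le \frac12\|T^*T+TT^*\|,$$ where the infimum is over all real $\alpha,\beta\ge0$ with $(\alpha,\beta)\neq(0,0)$.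
   Context: $\mathcal{B}(\mathcal{H})$ is the $C^*$-algebra of bounded linear operators on $\mathcal{H}$. $w(T)=\sup\{|\langle Tx,x\rangle|: \|x\|=1\}$ is the numerical radius, $\|T\|$ the operator norm, and $\|T\|_{\alpha,\beta}=\sup\left\{\sqrt{\alpha|\langle Tx,x\rangle|^2+\beta\|Tx\|^2}: x\in\mathcal{H},\|x\|=1\right\}$. *)

(* Defs.v *)
From HB Require Import structures.
From mathcomp Require Export all_boot all_order all_algebra sesquilinear complex.
From mathcomp Require Export all_classical all_reals all_analysis.
Export numFieldNormedType.Exports.
Export Order.TTheory GRing.Theory Num.Theory.

Set Implicit Arguments.
Unset Strict Implicit.
Unset Printing Implicit Defensive.

Local Open Scope classical_set_scope.
Local Open Scope ring_scope.
Local Open Scope complex_scope.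

(* The inner product is linear in its first argument and conjugate-linear in
   the second one. The norm of a complex normed space takes its values in
   R[i]. *)
HB.mixin Record isHilbert (R : realType) H
    of CompleteNormedModule R[i] H := {
  inner : {dot H for @Num.conj R[i]} ;
  inner_normE : forall x : H, inner x x = `|x| ^+ 2 }.

#[short(type="hilbertType")]
HB.structure Definition Hilbert (R : realType) :=
  {H of CompleteNormedModule R[i] H & isHilbert R H}.

(* The real-valued norm; for V = R[i] it is the modulus. *)
Definition rnorm (R : realType) (V : normedZmodType R[i]) (x : V) : R :=
  complex.Re `|x|.

Section Operators.
Variables (R : realType) (H : hilbertType R).
Implicit Types T A : H -> H.

Definition unit_sphere : set H := [set x | rnorm x = 1].

(* The suprema below are taken in R, where sup set0 = 0: for H = 0 they all
   vanish. *)
Definition opnorm A : R := sup [set rnorm (A x) | x in unit_sphere].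

Definition numrad T : R := sup [set rnorm (inner (T x) x) | x in unit_sphere].

Definition abnorm (a b : R) T : R :=
  sup [set Num.sqrt (a * rnorm (inner (T x) x) ^+ 2 + b * rnorm (T x) ^+ 2)
      | x in unit_sphere].

(* For a bounded linear T exactly one function S satisfies this condition, by
   the Riesz representation theorem; for other T the value may be arbitrary. *)
Definition adjoint T : H -> H :=
  get [set S : H -> H | forall x y, inner (T x) y = inner x (S y)].

Definition adjsum T : H -> H :=
  fun x => adjoint T (T x) + T (adjoint T x).

Definition adjcomb (c b : R) T : H -> H :=
  fun x => c%:C *: adjsum T x + b%:C *: adjoint T (T x).

End Operators.

(* Main.v *)
(* The adjoint T' exists by the Riesz representation theorem: a minimizing
   sequence of |x|^2 - 2 Re f(x) is Cauchy by the parallelogram identity.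

   Everything rests on the two bounds
     |<T x, x>|^2 <= (|T x|^2 + |T' x|^2) / 2  (|x| = 1),
     |T'T + TT'| <= 4 w(T)^2                   (Kittaneh).
   The first is Cauchy-Schwarz for <T x, x> = <x, T' x>. For the second, put
   U = T + T' and V = i (T - T'); these are self-adjoint with U^2 + V^2 =
   2 (T'T + TT'), and the norm of a self-adjoint operator is its numerical
   radius. The first bound gives (ii); the second, with a w(T)^2 <= N^2,
   b |T|^2 <= N^2 for N = |T|_{a,b} and the triangle inequality, gives (i).
   Finally (a + b) w(T)^2 <= N^2 and (ii) bound the infimum from below, and
   (a, b) = (1, 0) bounds it from above. *)
Require Import Defs.
From mathcomp Require Import ring lra.

Local Open Scope classical_set_scope.
Local Open Scope ring_scope.
Local Open Scope complex_scope.

(** * Real parts of complex numbers *)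

Lemma Re_conj (R : realType) (z : R[i]) :
  complex.Re (Num.conj z) = complex.Re z.
Proof. by case: z. Qed.

Lemma Re_realM (R : realType) (t : R) (z : R[i]) :
  complex.Re (t%:C * z) = t * complex.Re z.
Proof. by case: z => a b /=; rewrite mul0r subr0. Qed.

Lemma Re_iM (R : realType) (z : R[i]) : complex.Re ('i * z) = - complex.Im z.
Proof. by case: z => a b /=; rewrite mul0r mul1r sub0r. Qed.

Lemma Re_add (R : realType) (z t : R[i]) :
  complex.Re (z + t) = complex.Re z + complex.Re t.
Proof. by case: z; case: t. Qed.

(** * The real-valued norm *)

Section RealNorm.
Set Implicit Arguments.
Unset Strict Implicit.
Variables (R : realType) (V : normedModType R[i]).
Implicit Types x y : V.

Lemma rnormE (W : normedZmodType R[i]) (x : W) : `|x| = (rnorm x)%:C.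
Proof. by rewrite RRe_real// normr_real. Qed.

Lemma rnorm_ge0 (W : normedZmodType R[i]) (x : W) : 0 <= rnorm x.
Proof. by rewrite -lecR -rnormE normr_ge0. Qed.

Lemma rnormD (W : normedZmodType R[i]) (x y : W) :
  rnorm (x + y) <= rnorm x + rnorm y.
Proof. by rewrite -lecR rmorphD/= -!rnormE ler_normD. Qed.

Lemma rnormN (W : normedZmodType R[i]) (x : W) : rnorm (- x) = rnorm x.
Proof. by rewrite /rnorm normrN. Qed.

Lemma rnormM (z t : R[i]) : rnorm (z * t) = rnorm z * rnorm t.
Proof. by apply: complexI; rewrite rmorphM/= -!rnormE normrM. Qed.

Lemma rnormZ (z : R[i]) x : rnorm (z *: x) = rnorm z * rnorm x.
Proof. by apply: complexI; rewrite rmorphM/= -!rnormE normrZ. Qed.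

Lemma rnormC (t : R) : 0 <= t -> rnorm (t%:C : R[i]) = t.
Proof. by move=> t0; rewrite /rnorm ger0_norm ?lecR. Qed.

Lemma rnorm_eq0 x : rnorm x = 0 -> x = 0.
Proof. by move=> x0; apply/eqP; rewrite -normr_eq0 rnormE x0. Qed.

Lemma rnorm0 (W : normedZmodType R[i]) : rnorm (0 : W) = 0.
Proof. by rewrite /rnorm normr0. Qed.

Lemma Re_le_rnorm (z : R[i]) : `|complex.Re z| <= rnorm z.
Proof. by rewrite -lecR -rnormE normc_ge_Re. Qed.

Lemma Im_le_rnorm (z : R[i]) : `|complex.Im z| <= rnorm z.
Proof.
rewrite -normrN -Re_iM (le_trans (Re_le_rnorm _))//.
rewrite -lecR -!rnormE normrM.
suff -> : `|'i : R[i]| = 1 by rewrite mul1r.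
by rewrite normc_def/= expr0n/= add0r expr1n sqrtr1.
Qed.
End RealNorm.

(** * The real part of the inner product, and Cauchy-Schwarz *)

Section RealInner.
Set Implicit Arguments.
Unset Strict Implicit.
Variables (R : realType) (H : hilbertType R).
Implicit Types x y z : H.

Definition rip x y : R := complex.Re (inner x y).

Lemma innerC x y : inner x y = Num.conj (inner y x).
Proof. by rewrite hermC expr0 mul1r. Qed.

Lemma ripC x y : rip x y = rip y x.
Proof. by rewrite /rip innerC Re_conj. Qed.

Lemma ripDl x y z : rip (x + y) z = rip x z + rip y z.
Proof. by rewrite /rip linearDl Re_add. Qed.

Lemma ripZl (t : R) x z : rip (t%:C *: x) z = t * rip x z.
Proof. by rewrite /rip linearZl_LR Re_realM. Qed.

Lemma ripDr x y z : rip z (x + y) = rip z x + rip z y.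
Proof. by rewrite ripC ripDl !(ripC z). Qed.

Lemma ripZr (t : R) x z : rip z (t%:C *: x) = t * rip z x.
Proof. by rewrite ripC ripZl ripC. Qed.

Lemma ripNl x z : rip (- x) z = - rip x z.
Proof.
by rewrite -scaleN1r -(rmorph1 (real_complex R)) -rmorphN ripZl mulN1r.
Qed.

Lemma ripNr x z : rip z (- x) = - rip z x.
Proof. by rewrite ripC ripNl ripC. Qed.

Lemma rip_norm x : rip x x = rnorm x ^+ 2.
Proof. by rewrite /rip inner_normE rnormE -rmorphXn. Qed.

Lemma rip0l x : rip 0 x = 0.
Proof. by rewrite /rip linear0l. Qed.

(** Expand the square of the norm of |y| x - |x| y, which is nonnegative, and cancel |x| |y|. *)
Lemma rip_le x y : rip x y <= rnorm x * rnorm y.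
Proof.
have [x0|x0] := eqVneq (rnorm x) 0.
  by rewrite (rnorm_eq0 x0) rip0l rnorm0 mul0r.
have [y0|y0] := eqVneq (rnorm y) 0.
  by rewrite (rnorm_eq0 y0) ripC rip0l rnorm0 mulr0.
set m := rnorm y; set n := rnorm x.
have mn0 : 0 < m * n by rewrite mulr_gt0// lt_neqAle eq_sym ?x0 ?y0 rnorm_ge0.
have := sqr_ge0 (rnorm (m%:C *: x - n%:C *: y)).
rewrite -rip_norm !(ripDl, ripDr, ripNl, ripNr, ripZl, ripZr) !rip_norm.
rewrite (ripC y x) -/m -/n => h; rewrite -(ler_pM2l mn0); lra.
Qed.

(** Multiplying [x] by the conjugate of [inner x y] makes the inner product real, so that [rip_le]
    applies. *)
Lemma inner_le x y : rnorm (inner x y) <= rnorm x * rnorm y.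
Proof.
set z := inner x y.
have [z0|z0] := eqVneq (rnorm z) 0.
  by rewrite z0 mulr_ge0 ?rnorm_ge0.
have zp : 0 < rnorm z by rewrite lt_neqAle eq_sym z0 rnorm_ge0.
have := rip_le (Num.conj z *: x) y.
rewrite {1}/rip linearZl_LR/= -/z mulrC -normCK rnormE -rmorphXn/=.
rewrite rnormZ {2}/rnorm norm_conjC -/(rnorm z).
by rewrite expr2 -mulrA ler_pM2l.
Qed.

(** Lets a representation of real functionals yield the complex adjoint. *)
Lemma inner_rip x y : inner x y = (rip x y)%:C - 'i * (rip ('i *: x) y)%:C.
Proof.
rewrite /rip linearZl_LR/= Re_iM; case: (inner x y) => a b.
by apply/eqP; rewrite eq_complex/=; apply/andP; split; apply/eqP; ring.
Qed.

End RealInner.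

(** * Riesz representation of a bounded real-linear functional *)

Section Riesz.
Set Implicit Arguments.
Unset Strict Implicit.
Variables (R : realType) (H : hilbertType R).

Lemma parallelogram (x y : H) :
  rnorm (x - y) ^+ 2 = 2 * rnorm x ^+ 2 + 2 * rnorm y ^+ 2 - rnorm (x + y) ^+ 2.
Proof.
rewrite -!rip_norm !(ripDl, ripDr, ripNl, ripNr) (ripC y x); ring.
Qed.

Variables (f : H -> R) (C : R).
Hypotheses (fD : forall x y, f (x + y) = f x + f y)
  (fZ : forall (t : R) x, f (t%:C *: x) = t * f x)
  (f_le : forall x, f x <= C * rnorm x).

Let J x := rnorm x ^+ 2 - 2 * f x.

Let J_ge x : - C ^+ 2 <= J x.
Proof.
have := f_le x; have := sqr_ge0 (rnorm x - C); rewrite /J => ? ?; nra.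
Qed.

Let m := inf (range J).

Let lbJ : has_lbound (range J).
Proof. by exists (- C ^+ 2) => _ [x _ <-]; exact: J_ge. Qed.

Let m_le x : m <= J x.
Proof. by apply: ge_inf => //; exists x. Qed.

Let J_near e : 0 < e -> exists x, J x < m + e.
Proof.
move=> e0; have hJ : has_inf (range J) by split=> //; exists (J 0); exists 0.
by have [_ [x _ <-] ?] := inf_adherent e0 hJ; exists x.
Qed.

(** By the parallelogram identity the right side with [J] at the midpoint in place of [m] equals the
    left side. *)
Let J_dist x y : rnorm (x - y) ^+ 2 <= 2 * (J x + J y - 2 * m).
Proof.
have := m_le ((2^-1)%:C *: (x + y)).
rewrite {1}/J fZ fD -rip_norm ripZl ripZr rip_norm parallelogram /J => ?; lra.
Qed.

(** The sublevel sets of [J] above [m] generate a filter, which plays the role of a minimizing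
    sequence. *)
Lemma min_exists : exists p, forall x, J p <= J x.
Proof.
pose F := filter_from [set e : R | 0 < e] (fun e => [set x | J x < m + e]).
have FF : ProperFilter F.
  apply: filter_from_proper; last by move=> e /J_near.
  apply: filter_from_filter; first by exists 1 => /=.
  move=> i j /= i0 j0; exists (Num.min i j); first by rewrite /= lt_min i0.
  by move=> x /= xij; split=> /=; apply: (lt_le_trans xij);
    rewrite lerD2l ge_min lexx ?orbT.
have Fc : cauchy F.
  apply: cauchy_exP => eps; rewrite ltcE => /andP[/eqP/= e1 e0].
  have -> : eps = (complex.Re eps)%:C by case: eps e1 {e0} => ? ? /= ->.
  set e := complex.Re eps in e0 *.
  (* By [J_dist], two points with [J] below [m + e ^+ 2 / 8] have squared distance below
     [e ^+ 2 / 2]. *)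
  have d0 : 0 < e ^+ 2 / 8 by rewrite divr_gt0 ?exprn_gt0.
  have [x Jx] := J_near d0; exists x; exists (e ^+ 2 / 8) => // y /= Jy.
  rewrite -ball_normE /ball_ /= rnormE ltcR.
  rewrite -(ltr_pXn2r (n := 2)) ?nnegrE ?rnorm_ge0 ?(ltW e0)//.
  by have := J_dist x y => h; lra.
have /cvg_ex[p Fp] := @cauchy_cvg H F FF Fc.
exists p => x; apply: le_trans (m_le x); apply/ler_addgt0Pr => e e0.
(* [J p - J z] is at most 2 (|p| + |C|) |z - p|; the added 1 makes [K] positive. *)
set K := 2 * (rnorm p + `|C|) + 1.
have K0 : 0 < K by rewrite ltr_wpDl// mulr_ge0// addr_ge0//; exact: rnorm_ge0.
have e20 : 0 < e / 2 by lra.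
have d0 : 0 < e / 2 / K by rewrite divr_gt0.
have [z []] : ([set z | J z < m + e / 2] `&` ball p (e / 2 / K)%:C) !=set0.
  apply: (@filter_ex _ F); apply: filterI; first by exists (e / 2).
  by apply: Fp; apply: nbhsx_ballx; rewrite ltcR.
rewrite -ball_normE /ball_ /= rnormE ltcR -rnormN opprB => Jz.
rewrite ltr_pdivlMr// => zp.
have : J p <= J z + K * rnorm (z - p).
  have -> : J z = J p + 2 * rip p (z - p) + rnorm (z - p) ^+ 2 - 2 * f (z - p).
    have {1}-> : z = p + (z - p) by rewrite addrC subrK.
    rewrite /J fD -!rip_norm (ripDl p) !(ripDr _ _ p) !(ripDr _ _ (z - p)).
    by rewrite (ripC (z - p) p); ring.
  have := rip_le (- p) (z - p); rewrite ripNl rnormN => h1.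
  have h2 : f (z - p) <= `|C| * rnorm (z - p).
    by apply: le_trans (f_le _) _; rewrite ler_wpM2r ?rnorm_ge0 ?ler_norm.
  have := sqr_ge0 (rnorm (z - p)); have := rnorm_ge0 (z - p).
  rewrite /K => ? ?; nra.
by move=> h; lra.
Qed.

(** The first variation at a minimizer vanishes: the polynomial 2 t c + t^2 n is nonnegative for all
    t, which forces c = 0. *)
Lemma min_rip p : (forall x, J p <= J x) -> forall y, f y = rip y p.
Proof.
move=> Jp y; set c := rip y p - f y; set n := rnorm y ^+ 2.
have n0 : 0 <= n by exact: sqr_ge0.
have n1 : 0 < n + 1 by rewrite ltr_wpDl.
have h t : 0 <= 2 * t * c + t ^+ 2 * n.
  have := Jp (p + t%:C *: y).
  rewrite /J fD fZ -!rip_norm !(ripDl, ripDr, ripZl, ripZr).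
  rewrite (ripC p y) (rip_norm y) -/n.
  rewrite /c => ?; lra.
(* The denominator [n + 1] instead of [n] keeps this choice of t meaningful when [y = 0]. *)
have := h (- c / (n + 1)).
have -> : 2 * (- c / (n + 1)) * c + (- c / (n + 1)) ^+ 2 * n
   = - (c / (n + 1)) ^+ 2 * (n + 2) by field; rewrite gt_eqF.
rewrite mulNr oppr_ge0 => h2.
have : (c / (n + 1)) ^+ 2 = 0.
  apply/eqP; rewrite eq_le sqr_ge0 andbT -(ler_pM2r (x := n + 2)) ?mul0r//.
  by rewrite ltr_wpDl.
move/eqP; rewrite sqrf_eq0 mulf_eq0 invr_eq0 (gt_eqF n1) orbF /c subr_eq0.
by move/eqP.
Qed.

Lemma riesz : exists p, forall y, f y = rip y p.
Proof. by have [p Jp] := min_exists; exists p; exact: min_rip. Qed.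
End Riesz.

(** * Existence of the adjoint *)

Section Adjoint.
Set Implicit Arguments.
Unset Strict Implicit.
Variables (R : realType) (H : hilbertType R).

Lemma bounded_linear_le (T : {linear H -> H}) : bounded_near T (nbhs (0 : H)) ->
  exists2 M, 0 <= M & forall x, rnorm (T x) <= M * rnorm x.
Proof.
move/linear_boundedP => [M0 [M0r hM]].
(* [linear_boundedP] gives the bound only for constants strictly above [M0], which may be
   negative. *)
exists (`|complex.Re M0| + 1) => [|x]; first by rewrite addr_ge0.
rewrite -lecR rmorphM/= -!rnormE; apply: hM.
rewrite -(RRe_real M0r) ltcR; apply: le_lt_trans (ler_norm _) _.
by rewrite ltrDl.
Qed.

(** Riesz gives a representer for each [y]; choice assembles these into a function, so [get] selects
    from a nonempty set. *)
Lemma adjointP (T : {linear H -> H}) : bounded_near T (nbhs (0 : H)) ->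
  forall x y, inner (T x) y = inner x (adjoint T y).
Proof.
move=> /bounded_linear_le[M M0 hM].
suff h y : exists p, forall x, inner (T x) y = inner x p.
  have /choice[S hS] := h.
  exact: (@getPex _ [set S : H -> H | forall x y, inner (T x) y = inner x (S y)]
    (ex_intro _ S (fun x y => hS y x))).
have [|||p hp] := @riesz _ _ (fun x => rip (T x) y) (M * rnorm y).
- by move=> x z; rewrite linearD ripDl.
- by move=> t x; rewrite linearZ ripZl.
- move=> x; apply: le_trans (rip_le _ _) _.
  by rewrite mulrAC ler_wpM2r ?rnorm_ge0.
exists p => x; rewrite !inner_rip -(hp x) -(hp ('i *: x)).
by rewrite linearZ_LR.
Qed.

End Adjoint.

(** * Suprema over the unit sphere *)

Section SphereSup.
Set Implicit Arguments.
Unset Strict Implicit.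
Variables (R : realType) (H : hilbertType R).
Implicit Types g : H -> R.

Lemma le_sphere_sup g K x : (forall y, rnorm y = 1 -> g y <= K) ->
  rnorm x = 1 -> g x <= sup [set g x | x in @unit_sphere R H].
Proof.
by move=> gK x1; apply: ub_le_sup;
  [exists K => _ [y y1 <-]; exact: gK | exists x].
Qed.

(** [0 <= K] covers [H = 0], where the sphere is empty and the supremum is 0. *)
Lemma sphere_sup_le g K : 0 <= K -> (forall y, rnorm y = 1 -> g y <= K) ->
  sup [set g x | x in @unit_sphere R H] <= K.
Proof.
move=> K0 gK; set E := (X in sup X).
have [E0|/set0P E0] := eqVneq E set0; first by rewrite E0 sup0.
by apply: ge_sup => // _ [y y1 <-]; exact: gK.
Qed.

Lemma sphere_sup_ge0 g : (forall x, 0 <= g x) ->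
  0 <= sup [set g x | x in @unit_sphere R H].
Proof.
move=> g0; set E := (X in sup X).
have [hE|hE] := pselect (has_sup E); last by rewrite sup_out.
have [[_ [x x1 _]] ubE] := hE.
by apply: le_trans (g0 x) _; apply: ub_le_sup => //; exists x.
Qed.

(** For positive [c], the square root of [d / c] bounds [g] on the sphere, hence the supremum. *)
Lemma sphere_sup_sqr_le g c d : 0 <= c -> 0 <= d -> (forall x, 0 <= g x) ->
  (forall x, rnorm x = 1 -> c * g x ^+ 2 <= d) ->
  c * sup [set g x | x in @unit_sphere R H] ^+ 2 <= d.
Proof.
move=> c0 d0 g0 gd; have [->|cN0] := eqVneq c 0; first by rewrite mul0r.
have cp : 0 < c by rewrite lt_neqAle eq_sym cN0.
have dc0 : 0 <= d / c by rewrite divr_ge0.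
rewrite mulrC -ler_pdivlMr// -(sqr_sqrtr dc0) lerXn2r ?nnegrE ?sqrtr_ge0//.
  exact: sphere_sup_ge0.
apply: sphere_sup_le => [|x x1]; first exact: sqrtr_ge0.
by rewrite -(ger0_norm (g0 x)) -sqrtr_sqr ler_wsqrtr// ler_pdivlMr// mulrC gd.
Qed.

(** Carries homogeneous inequalities from the unit sphere to all vectors. *)
Lemma sphere_ind (P : H -> Prop) :
  P 0 -> (forall x, rnorm x = 1 -> P x) ->
  (forall (t : R) x, 0 < t -> P x -> P (t%:C *: x)) -> forall x, P x.
Proof.
move=> P0 P1 PZ x; have [x0|x0] := eqVneq (rnorm x) 0.
  by rewrite (rnorm_eq0 x0).
have xp : 0 < rnorm x by rewrite lt_neqAle eq_sym x0 rnorm_ge0.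
have -> : x = (rnorm x)%:C *: ((rnorm x)^-1%:C *: x).
  by rewrite scalerA -rmorphM/= divff// scale1r.
apply: PZ => //; apply: P1.
by rewrite rnormZ rnormC ?invr_ge0 ?rnorm_ge0// mulVf.
Qed.

End SphereSup.

(** * The norm of a self-adjoint operator *)

Section SelfAdjoint.
Set Implicit Arguments.
Unset Strict Implicit.
Variables (R : realType) (H : hilbertType R) (A : H -> H) (c : R).
Hypotheses (Asym : forall x y, rip (A x) y = rip x (A y))
  (Ac : forall x, `|rip (A x) x| <= c * rnorm x ^+ 2).

(* Polarization at [|A x| x] and [|x| A x]; symmetry makes linearity of [A]
   superfluous. *)
Lemma selfadjoint_norm_le x : rnorm (A x) <= c * rnorm x.
Proof.
set k := rnorm (A x); set n := rnorm x.
have [n0|nN0] := eqVneq n 0.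
  rewrite n0 mulr0 -(ler_pXn2r (n := 2)) ?nnegrE ?rnorm_ge0//.
  by rewrite -rip_norm Asym (rnorm_eq0 n0) rip0l expr0n.
have np : 0 < n by rewrite lt_neqAle eq_sym nN0 rnorm_ge0.
have [k0|kN0] := eqVneq k 0.
  have := Ac x; rewrite -/n k0 => h.
  have : 0 <= c * n ^+ 2 by apply: le_trans h; rewrite normr_ge0.
  by rewrite pmulr_lge0 ?exprn_gt0// => c0; rewrite mulr_ge0// ltW.
have kp : 0 < k by rewrite lt_neqAle eq_sym kN0 rnorm_ge0.
(* These weights give [u] and [v] the same norm [k * n]. *)
set u := k%:C *: x; set v := n%:C *: A x.
have hu : rnorm u ^+ 2 = k ^+ 2 * n ^+ 2.
  by rewrite rnormZ rnormC ?ltW// exprMn.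
have hv : rnorm v ^+ 2 = k ^+ 2 * n ^+ 2.
  by rewrite rnormZ rnormC ?ltW// exprMn mulrC.
have huv : rip (A u) v = k ^+ 3 * n.
  by rewrite Asym ripZl -Asym ripZr rip_norm -/k; ring.
have AD w : rip (A (u + w)) (u + w)
    = rip (A u) u + rip (A w) w + 2 * rip (A u) w.
  rewrite Asym ripDl -!Asym !ripDr (Asym w u) (ripC w); ring.
have Av : rip (A (- v)) (- v) = rip (A v) v.
  by rewrite Asym ripNl -Asym ripNr opprK.
have := Ac (u + v); have := Ac (u - v).
rewrite !AD Av ripNr huv => /ler_normlP[h1 _] /ler_normlP[_ h2].
have h3 : 4 * (k ^+ 3 * n) <= c * (rnorm (u + v) ^+ 2 + rnorm (u - v) ^+ 2).
  by lra.
move: h3; rewrite parallelogram addrC subrK hu hv => h3.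
(* Now 4 k^3 n <= 4 c k^2 n^2; cancelling k^2 n leaves the claim. *)
have kn0 : 0 < k ^+ 2 * n by rewrite mulr_gt0// exprn_gt0.
by rewrite -(ler_pM2l kn0); nra.
Qed.

End SelfAdjoint.

(** * Numerical radius, operator norm and the adjoint *)

Section NumericalRadius.
Set Implicit Arguments.
Unset Strict Implicit.
Variables (R : realType) (H : hilbertType R) (T : {linear H -> H}).
Hypothesis T_bounded : bounded_near T (nbhs (0 : H)).
Implicit Types x y : H.

Local Notation S := (adjoint T).
Local Notation w := (numrad T).

Lemma rip_i x y : rip ('i *: x) y = - rip x ('i *: y).
Proof.
rewrite /rip linearZl_LR linearZr_LR/=.
by case: (inner x y) => a b /=; ring.
Qed.

Lemma rip_ii x y : rip ('i *: x) ('i *: y) = rip x y.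
Proof.
by rewrite rip_i scalerA -expr2 sqr_i scaleN1r ripNr opprK.
Qed.

Lemma rip_adj x y : rip (T x) y = rip x (S y).
Proof. by rewrite /rip adjointP. Qed.

Lemma rip_adjr x y : rip (S x) y = rip x (T y).
Proof. by rewrite ripC -rip_adj ripC. Qed.

Lemma le_opnorm x : rnorm (T x) <= opnorm T * rnorm x.
Proof.
have [M M0 hM] := bounded_linear_le T_bounded.
elim/sphere_ind: x => [|x x1|t x t0 Tx].
- by rewrite linear0 !rnorm0 mulr0.
- rewrite x1 mulr1.
  apply: (@le_sphere_sup _ _ (fun x => rnorm (T x)) M) => // y y1.
  by rewrite -[M]mulr1 -y1.
- by rewrite linearZ_LR !rnormZ mulrCA ler_wpM2l ?rnorm_ge0.
Qed.

Lemma le_numrad x : rnorm (inner (T x) x) <= w * rnorm x ^+ 2.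
Proof.
elim/sphere_ind: x => [|x x1|t x t0 Tx].
- by rewrite linear0r !rnorm0 expr0n mulr0.
- rewrite x1 expr1n mulr1.
  apply: (@le_sphere_sup _ _ (fun x => rnorm (inner (T x) x))
    (opnorm T)) => // y y1.
  apply: le_trans (inner_le _ _) _.
  by rewrite y1 mulr1 (le_trans (le_opnorm _))// y1 mulr1.
- have -> : T (t%:C *: x) = t%:C *: T x by exact: linearZ_LR.
  rewrite linearZl_LR linearZr_LR/= mulrA.
  have -> : t%:C * Num.conj t%:C = (t ^+ 2)%:C.
    by rewrite /Num.conj/= oppr0 rmorphXn expr2.
  rewrite rnormM rnormZ !rnormC ?sqr_ge0 ?(ltW t0)// exprMn mulrCA.
  by rewrite ler_wpM2l// sqr_ge0.
Qed.

Lemma opnorm_ge0 (A : H -> H) : 0 <= opnorm A.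
Proof. by apply: sphere_sup_ge0 => x; exact: rnorm_ge0. Qed.

Lemma numrad_ge0 : 0 <= w.
Proof. by apply: sphere_sup_ge0 => x; exact: rnorm_ge0. Qed.

(** The quadratic forms of [U] and [V] are 2 Re <T x, x> and -2 Im <T x, x>, so both norms are at
    most [2 * w]. The identity for U^2 + V^2 enters only paired with [z], as [hz]. *)
Lemma adjsum_le x : rnorm (adjsum T x) <= 4 * w ^+ 2 * rnorm x.
Proof.
pose U y := T y + S y; pose V y := 'i *: (T y - S y).
have hU y : rnorm (U y) <= 2 * w * rnorm y.
  apply: selfadjoint_norm_le => {y} [y z|y].
    by rewrite /U ripDl ripDr rip_adj rip_adjr addrC.
  rewrite /U ripDl rip_adjr (ripC y) -[X in `|X|]mulr2n.
  rewrite -[X in `|X|]mulr_natl normrM ger0_norm//.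
  by rewrite -mulrA ler_pM2l//; apply: le_trans (Re_le_rnorm _) (le_numrad _).
have hV y : rnorm (V y) <= 2 * w * rnorm y.
  have iT u : 'i *: T u = T ('i *: u) by rewrite linearZ_LR.
  apply: selfadjoint_norm_le => {y} [y z|y].
    (* The scalar ['i] is moved across the pairing, where linearity of [T] handles it. *)
    have iS : rip (T y) ('i *: z) = rip y ('i *: S z).
      by apply: oppr_inj; rewrite -!rip_i iT rip_adj.
    rewrite /V rip_i !(ripDl, ripDr, ripNl, ripNr, scalerDr, scalerN).
    by rewrite rip_adjr iS iT; ring.
  rewrite /V scalerBr ripDl ripNl (rip_i (S y)) rip_adjr opprK -iT (ripC y).
  rewrite -[X in `|X|]mulr2n -[X in `|X|]mulr_natl normrM ger0_norm//.
  rewrite -mulrA ler_pM2l//.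
  rewrite /rip linearZl_LR/= Re_iM normrN.
  exact: le_trans (Im_le_rnorm _) (le_numrad _).
set z := adjsum T x.
have hz : 2 * rnorm z ^+ 2 = rip (U x) (U z) + rip (V x) (V z).
  have -> : rnorm z ^+ 2 = rip (T x) (T z) + rip (S x) (S z).
    by rewrite -rip_adjr -rip_adj -ripDl rip_norm.
  rewrite /V rip_ii /U !(ripDl, ripDr, ripNl, ripNr); ring.
have [z0|z0] := eqVneq (rnorm z) 0.
  by rewrite z0 mulr_ge0 ?rnorm_ge0// mulr_ge0// sqr_ge0.
have zp : 0 < rnorm z by rewrite lt_neqAle eq_sym z0 rnorm_ge0.
have w0 := numrad_ge0.
have hUU : rip (U x) (U z) <= (2 * w * rnorm x) * (2 * w * rnorm z).
  by apply: le_trans (rip_le _ _) _; rewrite ler_pM ?rnorm_ge0.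
have hVV : rip (V x) (V z) <= (2 * w * rnorm x) * (2 * w * rnorm z).
  by apply: le_trans (rip_le _ _) _; rewrite ler_pM ?rnorm_ge0.
by rewrite -(ler_pM2l zp); lra.
Qed.

(** |S x|^2 = <T S x, x> <= |T| |S x| |x|, and |S x| cancels. *)
Lemma adj_le x : rnorm (S x) <= opnorm T * rnorm x.
Proof.
have [z0|z0] := eqVneq (rnorm (S x)) 0.
  by rewrite z0 mulr_ge0 ?rnorm_ge0// opnorm_ge0.
have zp : 0 < rnorm (S x) by rewrite lt_neqAle eq_sym z0 rnorm_ge0.
rewrite -(ler_pM2l zp) -expr2 -rip_norm -rip_adj.
apply: le_trans (rip_le _ _) _; rewrite mulrCA.
by rewrite [leRHS]mulrA ler_wpM2r ?rnorm_ge0// le_opnorm.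
Qed.

(** Serves both for (i) and for the boundedness that makes [opnorm (adjcomb c b T)] an actual upper
    bound. *)
Lemma adjcomb_le (c b : R) x : 0 <= c -> 0 <= b ->
  rnorm (adjcomb c b T x) <= (c * (4 * w ^+ 2) + b * opnorm T ^+ 2) * rnorm x.
Proof.
move=> c0 b0; apply: le_trans (rnormD _ _) _.
rewrite !rnormZ !rnormC// mulrDl -(mulrA c) -(mulrA b) lerD// ler_wpM2l//.
  exact: adjsum_le.
apply: le_trans (adj_le _) _.
by rewrite expr2 -mulrA ler_wpM2l ?opnorm_ge0// le_opnorm.
Qed.

Lemma rip_adjcomb (c b : R) x :
  rip (adjcomb c b T x) x
  = c * (rnorm (T x) ^+ 2 + rnorm (S x) ^+ 2) + b * rnorm (T x) ^+ 2.
Proof.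
by rewrite ripDl !ripZl ripDl !rip_adjr (rip_adj (S x)) !rip_norm.
Qed.

Lemma rip_adjcomb_le (c b : R) x : 0 <= c -> 0 <= b -> rnorm x = 1 ->
  rip (adjcomb c b T x) x <= opnorm (adjcomb c b T).
Proof.
move=> c0 b0 x1; apply: le_trans (rip_le _ _) _; rewrite x1 mulr1.
apply: (@le_sphere_sup _ _ (fun x => rnorm (adjcomb c b T x))
  (c * (4 * w ^+ 2) + b * opnorm T ^+ 2)) => // y y1.
by apply: le_trans (adjcomb_le _ c0 b0) _; rewrite y1 mulr1.
Qed.

(** * Comparison with the (a, b)-norm *)

Variables (a b : R).
Hypotheses (a0 : 0 <= a) (b0 : 0 <= b).

Let abq x := a * rnorm (inner (T x) x) ^+ 2 + b * rnorm (T x) ^+ 2.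

Let abq_ge0 x : 0 <= abq x.
Proof. by rewrite addr_ge0// mulr_ge0// sqr_ge0. Qed.

Lemma le_abnorm x : rnorm x = 1 -> abq x <= abnorm a b T ^+ 2.
Proof.
move=> x1; rewrite -[leLHS](sqr_sqrtr (abq_ge0 x)) lerXn2r ?nnegrE ?sqrtr_ge0//.
  by apply: sphere_sup_ge0 => y; exact: sqrtr_ge0.
apply: (@le_sphere_sup _ _ (fun x => Num.sqrt (abq x))
  (Num.sqrt (a * w ^+ 2 + b * opnorm T ^+ 2))) => // y y1.
rewrite ler_wsqrtr// lerD// ler_wpM2l// lerXn2r ?nnegrE ?rnorm_ge0//.
- exact: numrad_ge0.
- by have := le_numrad y; rewrite y1 expr1n mulr1.
- exact: opnorm_ge0.
- by have := le_opnorm y; rewrite y1 mulr1.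
Qed.

Lemma numrad_abnorm : a * w ^+ 2 <= abnorm a b T ^+ 2.
Proof.
apply: sphere_sup_sqr_le => // [|x|x x1]; [exact: sqr_ge0|exact: rnorm_ge0|].
apply: le_trans (le_abnorm x1); rewrite /abq lerDl.
by rewrite mulr_ge0// sqr_ge0.
Qed.

Lemma opnorm_abnorm : b * opnorm T ^+ 2 <= abnorm a b T ^+ 2.
Proof.
apply: sphere_sup_sqr_le => // [|x|x x1]; [exact: sqr_ge0|exact: rnorm_ge0|].
apply: le_trans (le_abnorm x1); rewrite /abq lerDr.
by rewrite mulr_ge0// sqr_ge0.
Qed.

Lemma numradD_abnorm : (a + b) * w ^+ 2 <= abnorm a b T ^+ 2.
Proof.
apply: sphere_sup_sqr_le => // [||x|x x1];
  [exact: addr_ge0|exact: sqr_ge0|exact: rnorm_ge0|].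
apply: le_trans (le_abnorm x1); rewrite /abq mulrDl lerD2l ler_wpM2l//.
rewrite lerXn2r ?nnegrE ?rnorm_ge0//.
by apply: le_trans (inner_le _ _) _; rewrite x1 mulr1.
Qed.

(** The term with [w] contributes at most [d] times the squared (a, b)-norm and the term with
    [opnorm T] at most once. The values d = 1 and d = 2 give the two bounds in (i). *)
Lemma adjcomb_abnorm (d : R) : 0 <= d ->
  opnorm (adjcomb (d * a / 4) b T) <= (d + 1) * abnorm a b T ^+ 2.
Proof.
move=> d0; have N0 := sqr_ge0 (abnorm a b T).
have c0 : 0 <= d * a / 4 by rewrite divr_ge0// mulr_ge0.
have K : d * a / 4 * (4 * w ^+ 2) + b * opnorm T ^+ 2
    <= (d + 1) * abnorm a b T ^+ 2.
  by have := ler_wpM2l d0 numrad_abnorm; have := opnorm_abnorm; lra.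
apply: sphere_sup_le => [|x x1]; first by rewrite mulr_ge0// addr_ge0.
by apply: le_trans (adjcomb_le x c0 b0) _; rewrite x1 mulr1.
Qed.

Lemma abnorm_adjcomb : abnorm a b T ^+ 2 <= opnorm (adjcomb (a / 2) b T).
Proof.
have a20 : 0 <= a / 2 by rewrite divr_ge0.
rewrite -[leLHS]mul1r; apply: sphere_sup_sqr_le => // [|x x1].
   exact: opnorm_ge0.
rewrite mul1r sqr_sqrtr ?abq_ge0//; apply: le_trans (rip_adjcomb_le a20 b0 x1).
(* The common term in [b] and the factor [a] cancel; |<T x, x>|^2 remains to be bounded by the mean
   of |T x|^2 and |S x|^2. *)
rewrite rip_adjcomb lerD2r -mulrA ler_wpM2l//.
have h1 : rnorm (inner (T x) x) <= rnorm (T x).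
  by apply: le_trans (inner_le _ _) _; rewrite x1 mulr1.
have h2 : rnorm (inner (T x) x) <= rnorm (S x).
  by rewrite adjointP//; apply: le_trans (inner_le _ _) _; rewrite x1 mul1r.
have h0 := rnorm_ge0 (inner (T x) x); nra.
Qed.

End NumericalRadius.

(* A linear map is bounded in the usual sense iff it is bounded near 0
   (linear_boundedP). *)
Theorem theorem2p24 (R : realType) (H : hilbertType R) (T : {linear H -> H})
    (T_bounded : bounded_near T (nbhs (0 : H))) :
  (forall a b : R, 0 <= a -> 0 <= b -> (a, b) != (0, 0) ->
    Num.max (2^-1 * opnorm (adjcomb (a / 4) b T))
            (3^-1 * opnorm (adjcomb (a / 2) b T))
      <= abnorm a b T ^+ 2
    /\ abnorm a b T ^+ 2 <= opnorm (adjcomb (a / 2) b T))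
  /\
  (let m := inf [set r : R | exists a b : R,
                   [/\ 0 <= a, 0 <= b, (a, b) != (0, 0)
                     & r = (a + b)^-1 * opnorm (adjcomb (a / 2) b T)]] in
   numrad T ^+ 2 <= m
   /\ m <= 2^-1 * opnorm (adjsum T)).
Proof.
split=> [a b a0 b0 _|m].
  split; last exact: abnorm_adjcomb.
  have h4 := adjcomb_abnorm T_bounded a0 b0 ler01.
  have h2 := adjcomb_abnorm T_bounded a0 b0 (ler0n _ 2).
  have e2 : 2%:R * a / 4 = a / 2 by lra.
  rewrite e2 in h2; rewrite mul1r in h4.
  by rewrite ge_max; apply/andP; split; lra.
have lb r : (exists a b : R, [/\ 0 <= a, 0 <= b, (a, b) != (0, 0)
    & r = (a + b)^-1 * opnorm (adjcomb (a / 2) b T)]) -> numrad T ^+ 2 <= r.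
  move=> [a [b [a0 b0 ab ->]]].
  have ab0 : 0 < a + b.
    by rewrite lt_neqAle addr_ge0// andbT eq_sym paddr_eq0//.
  rewrite -(ler_pM2l ab0) mulVKf ?gt_eqF//.
  exact: le_trans (numradD_abnorm _ _ _) (abnorm_adjcomb _ _ _).
(* The member of the family at (1, 0), where the combination reduces to half of [adjsum T]. *)
have m1 : (1 + 0)^-1 * opnorm (adjcomb (1 / 2) 0 T) <= 2^-1 * opnorm (adjsum T).
  rewrite addr0 invr1 mul1r; apply: sphere_sup_le => [|x x1].
    by rewrite mulr_ge0// opnorm_ge0.
  rewrite /adjcomb scale0r addr0 rnormZ rnormC// mul1r ler_wpM2l//.
  apply: (@le_sphere_sup _ _ (fun x => rnorm (adjsum T x))
    (4 * numrad T ^+ 2)) => // y y1.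
  by rewrite (le_trans (adjsum_le T_bounded y))// y1 mulr1.
have n10 : ((1, 0) : R * R) != (0, 0) by rewrite xpair_eqE oner_eq0.
split.
  (* Comparison with [inf] needs a nonempty set here, and a lower bound, supplied by [lb], in the
     next part. *)
  apply: lb_le_inf => [|r]; last exact: lb.
  by exists ((1 + 0)^-1 * opnorm (adjcomb (1 / 2) 0 T)), 1, 0.
apply: le_trans m1; apply: ge_inf; last by exists 1, 0.
by exists (numrad T ^+ 2) => r; exact: lb.
Qed.
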